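(* Let $n\ge1$, $k\ge0$, and $\mathbb{F}$ a field. The $\mathbb{F}$-vector space $\mathrm{Loc}_k(\mathfrak{S}_n,\mathbb{F})$ of $k$-local statistics $\mathfrak{S}_n\to\mathbb{F}$ has basis $$\{\mathbf{1}_{\mathcal{S}(w)}: w\in\mathfrak{S}_n,\ \mathrm{lis}(w)\ge n-k\}.$$
   Context: A rook placement is a subset $\mathcal{R}\subseteq[n]\times[n]$ with at most one point in each row and column. A permutation $w$ extends $\mathcal{R}$ if $\mathcal{R}\subseteq\{(i,w(i)):1\le i\le n\}$; $\mathbf{1}_{\mathcal{R}}:\mathfrak{S}_n\to\mathbb{F}$ is $1$ on permutations extending $\mathcal{R}$ and $0$ otherwise. A function $f:\mathfrak{S}_n\to\mathbb{F}$ is $k$-local if $f=\sum_{|\mathcal{R}|=k}c_{\mathcal{R}}\mathbf{1}_{\mathcal{R}}$ for some $c_{\mathcal{R}}\in\mathbb{F}$, the sum over rook placements with exactly $k$ points; $\mathrm{Loc}_k(\mathfrak{S}_n,\mathbb{F})$ is the space of $k$-local functions. $\mathrm{lis}(w)$ is the length of the longest increasing subsequence of $w$. Shadow sets: for a finite set $X$ of lattice points with no two sharing an $x$- or $y$-coordinate, let $X_1$ be its componentwise-minimal points listed $(a_1,b_1),\dots,(a_r,b_r)$ with $a_1<\cdots<a_r$; the northeast corners of the first shadow line are $(a_{t+1},b_t)$, $1\le t<r$; remove $X_1$ and repeat. $\mathcal{S}(X)$ is the set of all such corners, and $\mathcal{S}(w)=\mathcal{S}(\{(i,w(i)):1\le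 i\le n\})$ (a rook placement).
   Formalization: The formal theorem assumes k ≤ n; for k > n there are no rook placements with exactly k points, so Loc_k = 0, while the claimed basis contains the nonzero function 1_{S(id)} = 1, and the claim is false there. *)

(* Defs.v *)
From HB Require Import structures.
From mathcomp Require Import all_boot all_order all_algebra all_fingroup.
Set Implicit Arguments.
Unset Strict Implicit.
Unset Printing Implicit Defensive.
Import GRing.Theory.

(* The grid [n] x [n] is 'I_n * 'I_n: coordinates run over 0, ..., n-1 instead
   of 1, ..., n; every notion below is invariant under this translation. *)

Definition rook_placement n (R : {set 'I_n * 'I_n}) : bool :=
  [forall p in R, forall q in R, ((p.1 == q.1) || (p.2 == q.2)) ==> (p == q)].

Definition perm_graph n (w : 'S_n) : {set 'I_n * 'I_n} :=
  [set (i, w i) | i : 'I_n].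

Definition perm_extends n (w : 'S_n) (R : {set 'I_n * 'I_n}) : bool :=
  R \subset perm_graph w.

(* F^o is F regarded as a one-dimensional vector space over itself; this makes
   the finite functions 'S_n -> F a vectType over F under pointwise
   operations. *)
Definition statistic (F : fieldType) n := {ffun 'S_n -> F^o}.

Definition rook_ind (F : fieldType) n (R : {set 'I_n * 'I_n}) :
    statistic F n :=
  [ffun w => if perm_extends w R then 1%R else 0%R].

Definition klocal (F : fieldType) n k (f : statistic F n) : Prop :=
  exists c : {set 'I_n * 'I_n} -> F,
    f = (\sum_(R : {set 'I_n * 'I_n} | rook_placement R && (#|R| == k))
           c R *: rook_ind F R)%R.

Definition Loc (F : fieldType) n k : {vspace statistic F n} :=
  <<[seq rook_ind F R | R <- enum {set 'I_n * 'I_n}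
                      & rook_placement R && (#|R| == k)]>>%VS.

Lemma mem_LocP (F : fieldType) n k (f : statistic F n) :
  f \in Loc F n k <-> klocal k f.
Proof.
split.
- rewrite /Loc span_def big_map big_filter big_enum_cond /= => /memv_sumP[v v_in ->].
  have vP R : exists a : F,
      rook_placement R && (#|R| == k) ==> (v R == (a *: rook_ind F R)%R).
    case: (boolP (_ && _)) => [PR|_]; last by exists 0%R.
    by have /vlineP[a Ea] := v_in R PR; exists a; apply/eqP.
  exists (fun R => xchoose (vP R)); apply: eq_bigr => R PR.
  by apply/eqP; move: PR; apply/implyP; exact: (xchooseP (vP R)).
- move=> [c ->]; apply: memv_suml => R PR; apply: memvZ; apply: memv_span.
  by apply/mapP; exists R; rewrite // mem_filter PR mem_enum.
Qed.

Definition lis n (w : 'S_n) : nat :=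
  \max_(A : {set 'I_n}
        | [forall i in A, forall j in A, (i < j) ==> (w i < w j)]) #|A|.

Definition min_points n (X : {set 'I_n * 'I_n}) : {set 'I_n * 'I_n} :=
  [set p in X | [forall q in X, ((q.1 <= p.1) && (q.2 <= p.2)) ==> (q == p)]].

Definition shadow_line n (X : {set 'I_n * 'I_n}) : seq ('I_n * 'I_n) :=
  sort (fun p q : 'I_n * 'I_n => p.1 <= q.1) (enum (min_points X)).

(* zip s (behead s) lists the pairs of consecutive entries of s, so the t-th
   pair ((a_t, b_t), (a_(t+1), b_(t+1))) yields the corner (a_(t+1), b_t). *)
Definition ne_corners n (X : {set 'I_n * 'I_n}) : {set 'I_n * 'I_n} :=
  let s := shadow_line X in
  [set r in [seq (pq.2.1, pq.1.2) | pq <- zip s (behead s)]].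

Definition peel n (X : {set 'I_n * 'I_n}) : {set 'I_n * 'I_n} :=
  X :\: min_points X.

(* #|X| rounds exhaust X, see iter_peel_card. *)
Definition shadow_set n (X : {set 'I_n * 'I_n}) : {set 'I_n * 'I_n} :=
  \bigcup_(t < #|X|) ne_corners (iter t (@peel n) X).

Lemma card_peel n (X : {set 'I_n * 'I_n}) : #|peel X| <= #|X|.-1.
Proof.
have [->|[p0 p0X]] := set_0Vmem X; first by rewrite /peel set0D cards0.
case: (arg_minnP (fun p : 'I_n * 'I_n => (p.1 + p.2)%N) p0X) => p pX pmin.
have pm : p \in min_points X.
  rewrite inE; apply/andP; split=> //; apply/forall_inP => q qX.
  apply/implyP => /andP[le1 le2]; have := pmin q qX => le12.
  rewrite -pair_eqE /pair_eq -!val_eqE /=.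
  rewrite !eqn_leq le1 le2 /=; apply/andP; split.
    by rewrite -(leq_add2r p.2) (leq_trans le12) // leq_add2l.
  by rewrite -(leq_add2l p.1) (leq_trans le12) // leq_add2r.
rewrite -ltnS prednK; last by apply/card_gt0P; exists p.
apply: proper_card; apply/properP; split; first exact: subsetDl.
by exists p => //; rewrite inE pm.
Qed.

Lemma iter_peel_card n (X : {set 'I_n * 'I_n}) :
  iter #|X| (@peel n) X = set0.
Proof.
apply/eqP; rewrite -cards_eq0 -leqn0 -[X in _ <= X](subnn #|X|).
elim: {1 3}#|X| => [|t IH] /=; first by rewrite subn0.
apply: leq_trans (card_peel _) _; rewrite subnS.
by rewrite -!subn1 leq_sub2r.
Qed.

Definition perm_shadow n (w : 'S_n) : {set 'I_n * 'I_n} :=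
  shadow_set (perm_graph w).

(* Main.v *)
(* Call a rook placement R admissible if, for every j, the part of R in the first j rows
   (and, symmetrically, in the first j columns) has r points and longest increasing chain of
   length m with m + r <= j.

   If rows violate this through a chain C, put Q = R \ C, let T be the set of columns of C, and
   let U be the rows among the first j that R avoids, so that #|U| < #|T|. For w extending Q, a column t in T
   has w^-1(t) either in U or in X = rows(C) u [j, n). Since w^-1 is injective it cannot map T
   into U, so expanding prod_(t in T) (1 - [w^-1(t) in U]) leaves only terms of degree < #|T|,
   while prod_(t in T) [w^-1(t) in X] expands into all ways of placing rooks in the columns T
   and rows X. Among these C itself is extremal for a weight favouring early antidiagonals, so
   1_R is a combination of indicators that are smaller or lighter. Columns follow by w -> w^-1.

   If R is admissible then R is the shadow set of some w, found by running Schensted's row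
   insertion backwards from the first tableau row given by the columns missing from R, and
   lis(w) >= n - #|R|. Hence the proposed family spans Loc_k. For k = n it consists of n!
   vectors spanning all statistics, so it is free, and so are its subfamilies. *)
Require Import Defs.
From HB Require Import structures.
From mathcomp Require Import all_boot all_order all_algebra all_fingroup zify.
Set Implicit Arguments.
Unset Strict Implicit.
Unset Printing Implicit Defensive.
Import GRing.Theory.

(** * Reverse row insertion *)

Definition rank n (P : {set 'I_n}) (j : nat) : nat := #|[set y in P | y < j]|.

(** With [lev] as the index of the shadow line, [x1] and [x] are consecutive points of one line, and
    [(x, y)] is the northeast corner between them. *)
Definition corner n (w : 'I_n -> 'I_n) (lev : 'I_n -> nat) (x y : 'I_n) :=
  exists x1 : 'I_n,
    [/\ x1 < x, w x1 = y, lev x1 = lev x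
      & forall x2 : 'I_n, x1 < x2 -> x2 < x -> lev x2 <> lev x].

(* The state of Schensted insertion after the rows [x < m]: [w x] is the inserted value, [lev x]
   its position in the first tableau row (the index of its shadow line), [P] the current first
   row, and [R] records each bumped value at the row that bumped it. *)
Record reading n (m : nat) (R : {set 'I_n * 'I_n}) (P : {set 'I_n})
    (w : 'I_n -> 'I_n) (lev : 'I_n -> nat) : Prop := Reading {
  reading_inj : forall x1 x2 : 'I_n,
    x1 < m -> x2 < m -> w x1 = w x2 -> x1 = x2;
  reading_img : forall x : 'I_n,
    x < m -> w x \in P \/ exists x', (x', w x) \in R;
  reading_mono : forall x1 x2 : 'I_n,
    x1 < x2 -> x2 < m -> w x1 < w x2 -> lev x1 < lev x2;
  reading_pred : forall x2 : 'I_n, x2 < m -> 0 < lev x2 ->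
    exists x1 : 'I_n, [/\ x1 < x2, w x1 < w x2 & lev x2 = (lev x1).+1];
  reading_corner : forall x y : 'I_n, x < m ->
    ((x, y) \in R) <-> corner w lev x y;
  reading_row : forall y, y \in P ->
    exists x : 'I_n, [/\ x < m, w x = y & lev x = rank P y];
  reading_last : forall x : 'I_n, x < m -> exists x1 : 'I_n,
    [/\ x1 < m, x <= x1, w x1 \in P, w x1 <= w x & lev x1 = lev x] }.

Lemma rank_lt n (P : {set 'I_n}) (y : 'I_n) (j : nat) :
  y \in P -> y < j -> rank P y < rank P j.
Proof.
move=> yP yj; apply: proper_card; apply/properP; split.
  by apply/subsetP => z; rewrite !inE => /andP[-> /= zy]; lia.
by exists y; rewrite !inE yP ?yj // ltnn.
Qed.

Lemma rank_inj n (P : {set 'I_n}) (y z : 'I_n) :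
  y \in P -> z \in P -> rank P y = rank P z -> y = z.
Proof.
move=> yP zP E; apply: val_inj => /=.
by case: (ltngtP y z) => // lt; [have := rank_lt yP lt | have := rank_lt zP lt];
  rewrite E ltnn.
Qed.

Lemma rank_pred n (P : {set 'I_n}) (j : nat) :
  0 < rank P j -> exists y : 'I_n, [/\ y \in P, y < j & rank P j = (rank P y).+1].
Proof.
move=> /card_gt0P[y0 y0j].
case: (arg_maxnP (P := [in [set y in P | y < j]]) val y0j) => y /=.
rewrite inE => /andP[yP yj] ymax; exists y; split=> //.
rewrite /rank (cardsD1 y) inE yP yj add1n; congr _.+1; apply: eq_card => z.
rewrite !inE; have [->|zy] := eqVneq z y; first by rewrite ltnn andbF.
case zP: (z \in P) => //=; apply/idP/idP => zj; last by lia.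
have := ymax z; rewrite inE zP zj => /(_ isT) /= lezy.
by rewrite ltn_neqAle lezy andbT.
Qed.

Lemma reading_rank n m R P w lev : @reading n m R P w lev ->
  forall x : 'I_n, x < m -> w x \in P -> lev x = rank P (w x).
Proof.
move=> rd x xm /(reading_row rd)[x' [x'm E <-]].
by rewrite (reading_inj rd x'm xm E).
Qed.

(* One insertion: row [m] inserts [a], turning the tableau row [P'] into [P]. *)
Lemma reading_step n (m : 'I_n) (R R' : {set 'I_n * 'I_n}) (P P' : {set 'I_n})
    (a : 'I_n) (w' : 'I_n -> 'I_n) (lev' : 'I_n -> nat) :
    reading m R' P' w' lev' ->
    a \in P -> a \notin P' -> (forall x, (x, a) \notin R') ->
    (forall y, y \in P -> y != a -> y \in P' /\ rank P' y = rank P y) ->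
    rank P' a = rank P a ->
    (forall y, y \in P' -> y \notin P -> (m, y) \in R /\ a < y) ->
    (forall y, ((m, y) \in R) <-> (y \in P' /\ rank P' y = rank P' a)) ->
    (forall x y, ((x, y) \in R') = (x != m) && ((x, y) \in R)) ->
  exists w lev, reading m.+1 R P w lev.
Proof.
move=> rd aP aP' aR' PP' ranka P'P rowm RR'.
pose w x := if x == m then a else w' x.
pose lev x := if x == m then rank P' a else lev' x.
have wm : w m = a by rewrite /w eqxx.
have levm : lev m = rank P' a by rewrite /lev eqxx.
have neqm (x : 'I_n) : x < m -> (x == m) = false.
  by move=> xm; apply/negbTE/eqP => E; rewrite E ltnn in xm.
have wE (x : 'I_n) : x < m -> w x = w' x by move=> /neqm E; rewrite /w E.
have levE (x : 'I_n) : x < m -> lev x = lev' x by move=> /neqm E; rewrite /lev E.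
have split_m (x : 'I_n) : x < m.+1 -> x = m \/ x < m.
  rewrite ltnS leq_eqVlt => /orP[/eqP E|]; [left | by right].
  exact: val_inj.
have w'a (x : 'I_n) : x < m -> w' x <> a.
  move=> xm E; case: (reading_img rd xm) => [|[x']]; rewrite E; apply/negP => //.
exists w, lev; split.
- move=> x1 x2 /split_m[->|lt1] /split_m[->|lt2] //; rewrite ?wm ?wE //.
  + by move=> /esym /(w'a _ lt2).
  + by move=> /(w'a _ lt1).
  + exact: (reading_inj rd).
- move=> x /split_m[->|lt]; rewrite ?wm ?wE //; first by left.
  case: (reading_img rd lt) => [yP'|[x' x'R']].
    by have [yP|/(P'P _ yP')[]] := boolP (w' x \in P); [left | right; exists m].
  by right; exists x'; move: x'R'; rewrite RR' => /andP[].
- move=> x1 x2 lt12 /split_m[E2|lt2]; last first.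
    have lt1 := ltn_trans lt12 lt2.
    by rewrite !wE // !levE //; apply: (reading_mono rd).
  subst x2; rewrite wm levm wE // levE // => lta.
  (* The row entry on the level of [x1] is at most [w' x1], hence below [a], so its rank is smaller
     than that of [a]. *)
  have [x' [x'm _ x'P lew <-]] := reading_last rd lt12.
  rewrite (reading_rank rd x'm x'P); apply: rank_lt => //.
  exact: leq_ltn_trans lta.
- move=> x2 /split_m[->|lt2]; last first.
    rewrite levE // => /(reading_pred rd lt2)[x1 [lt1 ltw El]].
    have lt1m := ltn_trans lt1 lt2.
    by exists x1; rewrite !wE // levE.
  rewrite levm wm => /rank_pred[y [yP' ya Ey]].
  have [x1 [lt1 E1 El]] := reading_row rd yP'.
  by exists x1; rewrite wE // levE // E1 El.
- move=> x y /split_m[->|lt]; last first.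
    have -> : ((x, y) \in R) = ((x, y) \in R') by rewrite RR' neqm.
    rewrite (reading_corner rd _ lt) /corner.
    split=> -[x1 [lt1 Ew El H]]; have lt1m := ltn_trans lt1 lt;
      exists x1; move: Ew El; rewrite !wE // !levE // => Ew El; split=> // x2 lt12 lt2;
      have := H x2 lt12 lt2; have lt2m := ltn_trans lt2 lt; by rewrite !levE.
  rewrite rowm /corner levm; split.
    move=> [yP' Ey]; have [x1 [lt1 E1 El]] := reading_row rd yP'.
    exists x1; rewrite wE // levE // El; split=> // x2 lt12 lt2; rewrite levE // => E2.
    (* A later point [x2] of this level would be followed by the row entry of the level. That entry
       is [y], already placed at the earlier [x1]. *)
    have [x3 [lt3 lt23 x3P' _ El3]] := reading_last rd lt2.
    have : w' x3 = w' x1.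
      rewrite E1; apply: (@rank_inj _ P') => //.
      by rewrite -(reading_rank rd lt3 x3P') El3 E2 Ey.
    by move=> /(reading_inj rd lt3 lt1) E31; subst x3; lia.
  move=> [x1 [lt1 E1 El H]]; move: E1 El; rewrite wE // levE // => E1 El.
  have [x3 [lt3 lt13 x3P' _ El3]] := reading_last rd lt1.
  have E13 : x1 = x3.
    apply: val_inj; apply/eqP; rewrite eqn_leq lt13 /= leqNgt; apply/negP => lt.
    by apply: (H x3) => //; rewrite levE // El3.
  subst x3; rewrite -E1; split=> //.
  by rewrite -(reading_rank rd lt1 x3P') El.
- move=> y yP; have [->|ya] := eqVneq y a; first by exists m; rewrite wm levm.
  have [yP' <-] := PP' y yP ya.
  have [x1 [lt1 E1 El]] := reading_row rd yP'.
  by exists x1; rewrite wE // levE //; split=> //; apply: ltnW.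
- move=> x /split_m[->|lt]; first by exists m; rewrite wm.
  have [x3 [lt3 lt13 x3P' le3 El3]] := reading_last rd lt.
  have [x3P|x3P] := boolP (w' x3 \in P).
    by exists x3; rewrite !wE // !levE //; split=> //; apply: ltnW.
  (* If the row entry of the level is bumped, row [m] takes over the level with the smaller value
     [a]. *)
  have [x3R ax3] := P'P _ x3P' x3P.
  exists m; rewrite wm levm wE // levE //; split=> //; [exact: ltnW | by lia |].
  by rewrite -El3 (reading_rank rd lt3 x3P'); case/rowm: x3R.
Qed.

(** Applied to both orders of a pair, the equality also makes distinct points differ in both
    coordinates, so chains increase strictly. *)
Definition chain n (C : {set 'I_n * 'I_n}) : bool :=
  [forall p in C, forall q in C, (p.1 < q.1) == (p.2 < q.2)].

Definition left_of n (R : {set 'I_n * 'I_n}) (j : nat) := [set p in R | p.1 < j].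

Lemma chainP n (C : {set 'I_n * 'I_n}) :
  reflect {in C &, forall p q : 'I_n * 'I_n, (p.1 < q.1) = (p.2 < q.2)} (chain C).
Proof.
apply: (iffP forall_inP) => [H p q pC qC|H p pC].
  exact: eqP (forall_inP (H p pC) q qC).
by apply/forall_inP => q qC; apply/eqP/H.
Qed.

Lemma chainU1 n (C : {set 'I_n * 'I_n}) (p : 'I_n * 'I_n) :
  chain C -> (forall q : 'I_n * 'I_n, q \in C -> q.1 < p.1 /\ q.2 < p.2) -> chain (p |: C).
Proof.
move=> /chainP chC Cp; apply/chainP => q r.
rewrite !inE => /predU1P[->|qC] /predU1P[->|rC].
- by rewrite !ltnn.
- by have [? ?] := Cp r rC; lia.
- by have [? ?] := Cp q qC; lia.
- exact: chC.
Qed.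

Lemma rook_placementP n (R : {set 'I_n * 'I_n}) :
  reflect {in R &, forall p q : 'I_n * 'I_n, p.1 = q.1 \/ p.2 = q.2 -> p = q} (rook_placement R).
Proof.
apply: (iffP forall_inP) => [H p q pR qR E|H p pR].
  apply/eqP; apply: (implyP (forall_inP (H p pR) q qR)).
  by case: E => ->; rewrite eqxx ?orbT.
apply/forall_inP => q qR; apply/implyP => /orP E; apply/eqP/H => //.
by case: E => /eqP; [left | right].
Qed.

Lemma rank_del n (P : {set 'I_n}) a j :
  a \in P -> rank (P :\ a) j + (a < j) = rank P j.
Proof.
move=> aP; rewrite /rank [in RHS](cardsD1 a) inE aP addnC; congr (_ + _).
by apply: eq_card => z; rewrite !inE andbA.
Qed.

Lemma rank_add n (P : {set 'I_n}) b j :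
  b \notin P -> rank (b |: P) j = rank P j + (b < j).
Proof.
move=> bP; have bP' : b \in b |: P by rewrite !inE eqxx.
rewrite -(rank_del _ bP'); congr (rank _ _ + _).
apply/setP => z; rewrite !inE; have [->|//] := eqVneq z b.
by rewrite (negbTE bP).
Qed.

Lemma rank_full n (P : {set 'I_n}) j : n <= j -> rank P j = #|P|.
Proof.
move=> nj; apply: eq_card => z; rewrite inE.
by rewrite (leq_trans (ltn_ord z) nj) andbT.
Qed.

(* Reverse insertion never gets stuck: the column condition on [P], which expresses that [P]
   stays entrywise below the next tableau row, is inherited by the previous state; when nothing
   was bumped at row [m], this is where the row condition is needed. *)
Lemma reading_exists n m (R : {set 'I_n * 'I_n}) (P : {set 'I_n}) :
    m <= n -> rook_placement R -> (forall p : 'I_n * 'I_n, p \in R -> p.1 < m) ->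
    (forall x y : 'I_n, (x, y) \in R -> y \notin P) -> #|P| + #|R| = m ->
    (forall (j : nat) (C : {set 'I_n * 'I_n}), j <= m -> C \subset left_of R j -> chain C ->
       #|C| + #|left_of R j| <= j) ->
    (forall (j : nat) (C : {set 'I_n * 'I_n}), j <= n -> C \subset R -> chain C ->
       (forall p : 'I_n * 'I_n, p \in C -> p.2 < j) -> #|C| <= rank P j) ->
  exists w lev, reading m R P w lev.
Proof.
elim: m R P => [|m IH] R P lemn rookR Rm RP cardPR rowR colR.
  exists id, (fun=> 0%N); split=> //.
  move=> y yP; have : 0 < #|P| by apply/card_gt0P; exists y.
  by lia.
pose mo : 'I_n := Ordinal lemn.
have left_R' (b : 'I_n) : forall j, j <= m -> left_of (R :\ (mo, b)) j = left_of R j.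
  move=> j jm; apply/setP => p; rewrite !inE.
  case: eqP => [->|//] /=; rewrite ltnNge jm; by rewrite andbF.
have [[b bR]|noR'] : (exists b : 'I_n, (mo, b) \in R) \/ forall b : 'I_n, (mo, b) \notin R.
  by case: (pickP (fun b : 'I_n => (mo, b) \in R)) => [b ?|H];
    [left; exists b | right => b; rewrite H].
- have bP := RP _ _ bR.
  have rkb : rank P b.+1 = rank P b.
    apply: eq_card => z; rewrite !inE ltnS leq_eqVlt.
    case zP: (z \in P) => //=; case: eqP => // /val_inj E.
    by rewrite -E zP in bP.
  have rank_b : 0 < rank P b.
    (* The one-point chain [(mo, b)] in the column condition at [b.+1] forces an entry of [P] below
       [b]. *)
    rewrite -rkb -(cards1 (mo, b)); apply: colR; rewrite ?sub1set //.
      by apply/chainP => p q; rewrite !inE => /eqP-> /eqP->; rewrite !ltnn.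
    by move=> p; rewrite inE => /eqP ->.
  (* Inserting [a] bumps the smallest entry above it; in reverse, [b] displaces the largest entry of
     [P] below [b]. *)
  have [a [aP ab rka]] := rank_pred rank_b.
  have neab : a != b by apply/eqP => E; rewrite E ltnn in ab.
  pose P' : {set 'I_n} := b |: (P :\ a).
  have inP' y : (y \in P') = (y == b) || (y != a) && (y \in P) by rewrite !inE.
  have rkP' j : rank P' j + (a < j) = rank P j + (b < j).
    by rewrite rank_add ?inE ?(negbTE bP) ?andbF // -(rank_del j aP) addnAC.
  have noab (y : 'I_n) : y \in P -> a < y -> b < y.
    move=> yP ay; rewrite ltnNge leq_eqVlt; apply/negP => /orP[/eqP/val_inj E|yb].
      by rewrite -E yP in bP.
    by have := rank_lt yP yb; have := rank_lt aP ay; lia.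
  have bR' (x : 'I_n) : (x, b) \notin R :\ (mo, b).
    rewrite !inE; apply/negP => /andP[/eqP ne xb]; apply: ne.
    by apply: (rook_placementP _ rookR) => //; right.
  have [w' [lev' rd]] : exists w lev,
      reading m (R :\ (mo, b)) P' w lev.
    apply: IH.
    + exact: ltnW.
    + apply/rook_placementP => p q; rewrite !inE => /andP[_ pR] /andP[_ qR].
      exact: (rook_placementP _ rookR).
    + move=> p; rewrite !inE => /andP[ne pR]; rewrite ltn_neqAle -ltnS Rm // andbT.
      apply/negP => /eqP E; case/negP: ne; apply/eqP.
      by apply: (rook_placementP _ rookR) => //; left; apply: val_inj.
    + move=> x y xy; rewrite inP' negb_or; apply/andP; split.
        by apply/eqP => E; move: xy; rewrite E; apply/negP.
      by move: xy; rewrite !inE => /andP[_ /RP/negbTE->]; rewrite andbF.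
    + move: cardPR; rewrite (cardsD1 a P) aP (cardsD1 (mo, b) R) bR !add1n addnS => -[<-].
      by rewrite cardsU1 in_setD1 (negbTE bP) andbF.
    + move=> j C jm; rewrite left_R' //; apply: rowR; lia.
    + move=> j C jn CR' chC Cj; have CR : C \subset R.
        exact: subset_trans CR' (subsetDl _ _).
      have [lt|ge] := boolP ((a < j) && (j <= b)); last first.
        by apply: leq_trans (colR j C jn CR chC Cj) _; have := rkP' j; lia.
      (* For [a < j <= b] the rank drops by one. Here [C] lies in earlier rows and in columns below
         [b], so [(mo, b)] extends it, and the column condition at [b.+1] supplies the missing
         unit. *)
      have := colR b.+1 ((mo, b) |: C) (ltn_ord b).
      have Cb p : p \in C -> p.1 < mo /\ p.2 < b.
        move=> pC; have := Cj p pC; have := Rm p (subsetP CR p pC).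
        have /subsetP/(_ p pC) := CR'; rewrite !inE => /andP[/eqP ne pR] lt1 lt2.
        case/andP: lt => ltaj lejb; split; last exact: leq_trans lt2 lejb.
        rewrite ltn_neqAle -ltnS lt1 andbT; apply/eqP => /val_inj E; apply: ne.
        by apply: (rook_placementP _ rookR) => //; left.
      rewrite subUset sub1set bR CR => /(_ isT) /(_ (chainU1 (p := (mo, b)) chC Cb)).
      have -> : #|(mo, b) |: C| = #|C|.+1.
        rewrite cardsU1; case: (boolP (_ \in C)) => // /Cb /=.
        by rewrite !ltnn => -[].
      rewrite rkb => leC; have {}leC : #|C| < rank P b.
        apply: leC => p; rewrite !inE => /predU1P[->//|/Cb[_ /ltnW]].
        by rewrite ltnS.
      by have := rank_lt aP (proj1 (andP lt)); have := rkP' j; lia.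
  apply: (@reading_step n mo R _ P P' a w' lev' rd) => //.
  + by rewrite inP' negb_or neab eqxx.
  + by move=> x; rewrite !inE; apply/negP => /andP[_ /RP]; rewrite aP.
  + move=> y yP ya; rewrite inP' yP ya orbT; split=> //.
    have := rkP' y; have := noab y yP.
    have : (y : nat) <> b by move=> /val_inj E; rewrite -E yP in bP.
    by lia.
  + by have := rkP' a; rewrite ltnn; lia.
  + by move=> y; rewrite inP' => /predU1P[->|/andP[_ ->]].
  + have rkab : rank P' b = rank P' a.
      by have := rkP' b; have := rkP' a; rewrite !ltnn; lia.
    have bP' : b \in P' by rewrite inP' eqxx.
    move=> y; split=> [yR|[yP' Ey]].
      have -> : y = b; last by [].
      by have := rook_placementP _ rookR _ _ yR bR (or_introl erefl) => -[].
    by have -> : y = b by apply: (rank_inj yP' bP'); rewrite Ey.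
  + move=> x y; rewrite !inE xpair_eqE; have [->|//] := eqVneq x mo.
    case: eqP => [->|ne] //=; apply/negP => yR; apply: ne.
    by have := rook_placementP _ rookR _ _ yR bR (or_introl erefl) => -[].
(* Row [m] bumps nothing, so its value is the largest entry of [P], appended at the end of the
   tableau row. *)
have Rm' p : p \in R -> p.1 < m.
  move=> pR; rewrite ltn_neqAle -ltnS Rm // andbT; apply/eqP => E.
  case/negP: (noR' p.2); have -> : mo = p.1 by apply: val_inj.
  by case: p pR {E}.
have left_m : left_of R m = R.
  by apply/setP => p; rewrite inE; case: (boolP (p \in R)) => //= /Rm'.
have leRm : #|R| <= m.
  have := rowR m set0 (leqnSn m) (sub0set _); rewrite cards0 left_m; apply.
  by apply/chainP => p q; rewrite inE.
have rkn : 0 < rank P n by rewrite rank_full //; lia.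
have [a [aP _ rka]] := rank_pred rkn.
have amax (y : 'I_n) : y \in P -> y != a -> y < a.
  move=> yP ya; rewrite ltn_neqAle ya leqNgt; apply/negP => ay.
  by have := rank_lt yP (ltn_ord y); have := rank_lt aP ay; lia.
pose P' : {set 'I_n} := P :\ a.
have inP' y : (y \in P') = (y != a) && (y \in P) by rewrite !inE.
have rkP' j : rank P' j + (a < j) = rank P j := rank_del j aP.
have [w' [lev' rd]] : exists w lev, reading m R P' w lev.
  apply: IH => //.
  + exact: ltnW.
  + by move=> x y /RP; rewrite inP' => /negbTE->; rewrite andbF.
  + by move: cardPR; rewrite (cardsD1 a P) aP => -[].
  + by move=> j C jm; apply: rowR; lia.
  + move=> j C jn CR chC Cj; have [aj|ja] := ltnP a j; last first.
      by have := colR j C jn CR chC Cj; have := rkP' j; lia.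
    (* Beyond [a] the rank of [P'] is [#|P| - 1 = m - #|R|], which is at least [#|C|] by the row
       condition at [m]. *)
    have := rowR m C (leqnSn m); rewrite left_m => /(_ CR chC).
    have := rkP' j; rewrite aj.
    suff : rank P j = #|P| by lia.
    rewrite -(rank_full P (leqnn n)); apply: eq_card => z; rewrite !inE ltn_ord.
    case zP: (z \in P) => //=; apply: leq_trans aj; rewrite ltnS.
    by have [->//|za] := eqVneq z a; apply/ltnW/amax.
apply: (@reading_step n mo R _ P P' a w' lev' rd) => //.
+ by rewrite inP' eqxx.
+ by move=> x; apply/negP => /RP; rewrite aP.
+ move=> y yP ya; rewrite inP' yP ya; split=> //.
  by have := rkP' y; have := amax y yP ya; lia.
+ by have := rkP' a; rewrite ltnn; lia.
+ by move=> y; rewrite inP' => /andP[_ ->].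
+ move=> y; rewrite (negbTE (noR' y)); split=> // -[yP' Ey].
  have := yP'; rewrite inP' => /andP[ya yP].
  by have := rank_lt yP' (amax y yP ya); lia.
+ move=> x y; have [->|//] := eqVneq x mo.
  by rewrite (negbTE (noR' y)).
Qed.

(** * Shadow lines as level sets *)

(** Replaces adjacency in a sorted list by the covering relation, so that corners can be described
    without positions. *)
Lemma mem_zip_behead (T : eqType) (lt : rel T) (s : seq T) :
    transitive lt -> irreflexive lt -> sorted lt s -> forall p q,
  ((p, q) \in zip s (behead s)) <->
  [/\ p \in s, q \in s, lt p q & forall r, r \in s -> ~~ (lt p r && lt r q)].
Proof.
move=> tr irr; have asym x y : lt x y -> lt y x -> False.
  by move=> xy /(tr _ _ _ xy); rewrite irr.
elim: s => [|x [|y s] IH]; first by move=> _ p q; split=> [//|[]].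
  by move=> _ p q; split=> // -[]; rewrite !inE => /eqP-> /eqP->; rewrite irr.
move=> ss p q; have /andP[xy ps] : lt x y && path lt y s by [].
have {}IH := IH ps p q.
have ltx r : r \in y :: s -> lt x r.
  by move/allP: (order_path_min tr ss); apply.
have lty r : r \in s -> lt y r by move/allP: (order_path_min tr ps); apply.
have -> : ((p, q) \in zip [:: x, y & s] (behead [:: x, y & s])) =
    ((p, q) == (x, y)) || ((p, q) \in zip (y :: s) s) by rewrite /= in_cons.
split.
  case/predU1P => [[-> ->]|/IH[pys qys pq H]].
    split; rewrite ?in_cons ?eqxx ?orbT //= => r rs.
    case/predU1P: rs => [->|/predU1P[->|/lty yr]]; rewrite ?irr ?andbF //.
    by apply/negP => /andP[_ /(asym _ _ yr)].
  split=> //; [by rewrite in_cons pys orbT | by rewrite in_cons qys orbT |].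
  move=> r /predU1P[->|/H //]; apply/negP => /andP[px _].
  exact: asym px (ltx _ pys).
move=> [p_in q_in pq H].
case/predU1P: q_in => [qx|qys].
  case/predU1P: p_in => [px|/ltx xp]; first by rewrite px qx irr in pq.
  by rewrite qx in pq; case: (asym _ _ pq xp).
case/predU1P: p_in => [px|pys].
  case/predU1P: qys => [qy|/lty yq]; first by rewrite px qy eqxx.
  have := H y; rewrite !in_cons eqxx orbT px => /(_ isT).
  by rewrite xy yq.
apply/orP; right; apply/IH; split=> // r rs; apply: H.
by rewrite in_cons rs orbT.
Qed.

Lemma mem_ne_corners n (X : {set 'I_n * 'I_n}) (x y : 'I_n) :
    {in X &, forall p q : 'I_n * 'I_n, p.1 = q.1 -> p = q} ->
  ((x, y) \in ne_corners X) <->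
  exists x1 y2 : 'I_n, [/\ (x1, y) \in min_points X, (x, y2) \in min_points X, x1 < x
    & forall r : 'I_n * 'I_n, r \in min_points X -> ~~ (x1 < r.1 < x)].
Proof.
move=> injX; pose lt := [rel p q : 'I_n * 'I_n | p.1 < q.1].
have sX p : (p \in shadow_line X) = (p \in min_points X).
  by rewrite mem_sort mem_enum.
have ss : sorted lt (shadow_line X).
  suff : sorted ltn [seq val p.1 | p <- shadow_line X] by rewrite sorted_map.
  rewrite ltn_sorted_uniq_leq sorted_map sort_sorted ?andbT; last first.
    by move=> p q; apply: leq_total.
  rewrite map_inj_in_uniq ?sort_uniq ?enum_uniq // => p q.
  rewrite !sX !inE => /andP[pX _] /andP[qX _] /val_inj; exact: injX.
have zipP p q := @mem_zip_behead _ lt _ (fun _ _ _ => @ltn_trans _ _ _)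
  (fun p => ltnn p.1) ss p q.
rewrite inE; split.
  case/mapP => -[[x1 y1] [x2 y2]] /zipP[p_in q_in pq H] [-> ->].
  exists x1, y2; rewrite -!sX; split=> // r; rewrite -sX; exact: H.
case=> x1 [y2 [p_in q_in lt1 H]]; apply/mapP; exists ((x1, y), (x, y2)) => //.
by apply/zipP; split; rewrite ?sX // => r; rewrite sX; apply: H.
Qed.

(** The two hypotheses determine [lev]: [(lev x).+1] is the length of the longest increasing
    subsequence ending at [x]. *)
Section ShadowLevels.

Variables (n : nat) (w : 'S_n) (lev : 'I_n -> nat).
Hypothesis lev_mono : forall x1 x2 : 'I_n, x1 < x2 -> w x1 < w x2 -> lev x1 < lev x2.
Hypothesis lev_pred : forall x2 : 'I_n, 0 < lev x2 ->
  exists x1 : 'I_n, [/\ x1 < x2, w x1 < w x2 & lev x2 = (lev x1).+1].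

Lemma mem_perm_graph (x y : 'I_n) : ((x, y) \in perm_graph w) = (y == w x).
Proof.
by apply/imsetP/eqP => [[i _ [-> ->]] //|->]; exists x.
Qed.

(** A point of level above [t] has a predecessor of level at least [t] to its southwest, while
    anything southwest of a point of level [t] has a lower level and is gone from [X]. *)
Lemma mem_min_points_lev (X : {set 'I_n * 'I_n}) t :
    (forall x y : 'I_n, ((x, y) \in X) = (y == w x) && (t <= lev x)) ->
  forall x y : 'I_n, ((x, y) \in min_points X) = (y == w x) && (lev x == t).
Proof.
move=> XE x y; rewrite inE XE; case: eqP => [->|//] /=.
have [lt|gt|E] := ltngtP t (lev x) => //=.
  apply/negbTE/negP => /forall_inP H.
  have [x1 [lt1 ltw El]] : exists x1 : 'I_n,
    [/\ x1 < x, w x1 < w x & lev x = (lev x1).+1] by apply: lev_pred; lia.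
  have x1X : (x1, w x1) \in X by rewrite XE eqxx; lia.
  have := H _ x1X; rewrite /= (ltnW lt1) (ltnW ltw) xpair_eqE => /andP[/eqP E _].
  by rewrite E ltnn in lt1.
apply/forall_inP => -[x1 y1]; rewrite XE => /andP[/eqP-> lt1] /=.
apply/implyP => /andP[le1 le2]; rewrite xpair_eqE.
have [->|ne] := eqVneq x1 x; first by rewrite eqxx.
have : lev x1 < lev x.
  by apply: lev_mono; rewrite ltn_neqAle ?le1 ?le2 ?andbT // val_eqE (inj_eq perm_inj).
by lia.
Qed.

Lemma mem_iter_peel t (x y : 'I_n) :
  ((x, y) \in iter t (@peel n) (perm_graph w)) = (y == w x) && (t <= lev x).
Proof.
elim: t x y => [|t IH] x y /=; first by rewrite mem_perm_graph andbT.
rewrite in_setD (mem_min_points_lev IH) IH.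
by case: eqP => //= _; case: (ltngtP t (lev x)).
Qed.

Lemma card_perm_graph : #|perm_graph w| = n.
Proof. by rewrite card_imset ?card_ord // => i j []. Qed.

Lemma mem_perm_shadow (x y : 'I_n) : ((x, y) \in perm_shadow w) <-> corner w lev x y.
Proof.
have cornersP t := @mem_ne_corners n (iter t (@peel n) (perm_graph w)) x y.
have inj t : {in iter t (@peel n) (perm_graph w) &,
    forall p q : 'I_n * 'I_n, p.1 = q.1 -> p = q}.
  move=> [x1 y1] [x2 y2]; rewrite !mem_iter_peel => /andP[/eqP-> _] /andP[/eqP-> _].
  by move=> /= ->.
have minE t := mem_min_points_lev (mem_iter_peel t).
split.
  case/bigcupP => t _ /(cornersP _ (inj t))[x1 [y2 []]]; rewrite !minE.
  move=> /andP[/eqP Ey /eqP E1] /andP[_ /eqP E2] lt1 H.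
  exists x1; split=> //; first by rewrite E1.
  move=> x2 lt12 lt2 El; have := H (x2, w x2); rewrite minE eqxx El E2 eqxx.
  by rewrite lt12 lt2 => /(_ isT).
move=> [x1 [lt1 Ey El H]]; apply/bigcupP.
(* The union in [shadow_set] stops at the cardinality of the graph; peeling has exhausted the graph
   by then, so the round [lev x] is in range. *)
have ltn : lev x < #|perm_graph w|.
  rewrite ltnNge; apply/negP => le.
  have := mem_iter_peel #|perm_graph w| x (w x).
  by rewrite iter_peel_card inE eqxx le.
exists (Ordinal ltn) => //=; apply/(cornersP _ (inj _)).
exists x1, (w x); rewrite !minE El -Ey !eqxx; split=> // -[x2 y2].
rewrite minE => /andP[_ /eqP E2] /=; apply/negP => /andP[lt12 lt2].
exact: H lt12 lt2 E2.
Qed.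

(** Following [lev_pred] down to level 0 collects [(lev x).+1] points. The induction also records
    that all of them lie southwest of [x], so that the next point can be added. *)
Lemma lev_lt_lis (x : 'I_n) : lev x < lis w.
Proof.
have [A [incA cardA _]] : exists A : {set 'I_n},
    [/\ [forall i in A, forall j in A, (i < j) ==> (w i < w j)],
        #|A| = (lev x).+1
      & x \in A /\ forall i, i \in A -> i = x \/ (i < x) && (w i < w x)].
  have [l El] : exists l, lev x = l by exists (lev x).
  elim: l x El => [|l IH] x El.
    exists [set x]; split; rewrite ?cards1 ?El ?inE ?eqxx //.
      apply/forall_inP => i; rewrite inE => /eqP->; apply/forall_inP => j.
      by rewrite inE => /eqP->; rewrite ltnn.
    by split=> // i; rewrite inE => /eqP; left.
  have [x1 [lt1 ltw El1]] : exists x1 : 'I_n,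
    [/\ x1 < x, w x1 < w x & lev x = (lev x1).+1] by apply: lev_pred; rewrite El.
  have [|A [incA cardA [x1A Ax1]]] := IH x1; first by lia.
  have Ax i : i \in A -> (i < x) && (w i < w x).
    by move=> /Ax1[->|/andP[? ?]]; apply/andP; split => //; lia.
  exists (x |: A); split.
  - apply/forall_inP => i /setU1P iA; apply/forall_inP => j /setU1P jA.
    case: iA jA => [->|iA] [->|jA]; first by rewrite ltnn.
    + by have /andP[ltj _] := Ax j jA; apply/implyP; lia.
    + by have /andP[_ ->] := Ax i iA; apply/implyP.
    + exact: (forall_inP (forall_inP incA i iA) j jA).
  - rewrite cardsU1 cardA -El1; case: (boolP (x \in A)) => // xA.
    by have := Ax x xA; rewrite ltnn.
  - split=> [|i]; first by rewrite !inE eqxx.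
    by move=> /setU1P[->|iA]; [left | right; apply: Ax].
rewrite -cardA; exact: (@leq_bigmax_cond _ _ (fun A : {set 'I_n} => #|A|)).
Qed.

End ShadowLevels.

(** * Counting corners against increasing chains *)

Lemma card_ne_corners n (X : {set 'I_n * 'I_n}) :
  #|ne_corners X| <= #|min_points X|.-1.
Proof.
rewrite cardsE; apply: leq_trans (card_size _) _.
rewrite size_map size_zip size_behead size_sort -cardE.
by rewrite geq_minr.
Qed.

Lemma card_ne_corners_peel n (X : {set 'I_n * 'I_n}) :
  #|ne_corners X| + #|peel X| + (0 < #|X|) <= #|X|.
Proof.
have := card_ne_corners X; have := card_peel X.
have : #|peel X| + #|min_points X| = #|X|.
  rewrite addnC -(cardsID (min_points X) X); congr (#|pred_of_set _| + _).
  by apply/setP => p; rewrite !inE; case: (p \in X).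
by lia.
Qed.

(** Minimal points form an antichain, so a chain loses at most one point per round of peeling. *)
Lemma card_chain_min_points n (X C : {set 'I_n * 'I_n}) :
  C \subset X -> chain C -> #|C| <= #|C :&: peel X|.+1.
Proof.
move=> CX /chainP chC; rewrite -(cardsID (peel X) C) -addn1 leq_add2l.
have minC p : p \in C :\: peel X -> [/\ p \in C, p \in X &
    forall q, q \in X -> (q.1 <= p.1) && (q.2 <= p.2) -> q == p].
  rewrite in_setD => /andP[pN pC]; have pX := subsetP CX p pC.
  move: pN; rewrite in_setD pX andbT negbK inE pX => /forall_inP H.
  by split=> // q qX; apply: implyP (H q qX).
apply/card_le1_eqP => p q /minC[pC pX pm] /minC[qC qX qm].
have := pm q qX; have := qm p pX.
have := chC p q pC qC; have := chC q p qC pC.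
case: (ltngtP p.1 q.1) => // E1; case: (ltngtP p.2 q.2) => // E2 _ _.
- by move=> /(_ isT)/eqP->.
- by move=> _ /(_ isT)/eqP->.
- by move=> /(_ isT)/eqP->.
Qed.

(** Each nonempty round removes at least one more point than it yields corners, and exhausting [C]
    takes at least [#|C|] rounds. *)
Lemma card_shadow_set_chain n (X C : {set 'I_n * 'I_n}) :
  C \subset X -> chain C -> #|shadow_set X| + #|C| <= #|X|.
Proof.
move=> CX chC.
(* The term [minn t #|C|] counts rounds in which points of [C] surely remain, each of which saves
   one point. *)
have H t : \sum_(s < t) #|ne_corners (iter s (@peel n) X)| +
    #|iter t (@peel n) X| + minn t #|C| <= #|X| /\
    #|C| <= #|C :&: iter t (@peel n) X| + t.
  elim: t => [|t [IH1 IH2]]; first by rewrite big_ord0 /= (setIidPl CX); lia.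
  have chCt : chain (C :&: iter t (@peel n) X).
    apply/chainP => p q; rewrite !inE => /andP[pC _] /andP[qC _].
    exact: (chainP _ chC).
  have := card_chain_min_points (subsetIr C (iter t (@peel n) X)) chCt.
  have := subset_leq_card (subsetIr C (iter t (@peel n) X)).
  have := card_ne_corners_peel (iter t (@peel n) X).
  have : #|C :&: iter t (@peel n) X :&: peel (iter t (@peel n) X)| =
      #|C :&: iter t.+1 (@peel n) X|.
    apply: eq_card => p; rewrite !inE /=.
    by case: (p \in C) => //=; case: (p \in iter t _ X); rewrite ?andbF.
  rewrite big_ord_recr /=; move: IH1 IH2; set Y := iter t _ X.
  set S := \sum_(_ < t) _; set a := #|Y|; set b := #|peel Y|; set c := #|C|.
  set d := #|C :&: Y|; set e := #|C :&: peel Y|; set f := #|C :&: Y :&: peel Y|.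
  by set g := #|ne_corners Y|; set h := #|X|; lia.
have [] := H #|X|; rewrite iter_peel_card setI0 cards0 add0n addn0 => H1 H2.
apply: leq_trans H1; rewrite (minn_idPr H2) leq_add2r.
rewrite /shadow_set; elim/big_ind2: _ => [|a A b B la lb|//]; first by rewrite cards0.
by rewrite cardsU; apply: leq_trans (leq_subr _ _) _; apply: leq_add.
Qed.

Lemma card_perm_shadow n (w : 'S_n) : #|perm_shadow w| + lis w <= n.
Proof.
have H (A : {set 'I_n}) : [forall i in A, forall j in A, (i < j) ==> (w i < w j)] ->
    #|perm_shadow w| + #|A| <= n.
  move=> /forall_inP incA; have inc i j : i \in A -> j \in A -> i < j -> w i < w j.
    by move=> iA jA; apply/implyP; exact: (forall_inP (incA i iA) j jA).
  rewrite -[n in _ <= n](card_perm_graph w).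
  have inj : injective (fun i => (i, w i)) by move=> i j [].
  rewrite -(card_imset A inj); apply: card_shadow_set_chain.
    by apply/subsetP => _ /imsetP[i _ ->]; apply: imset_f.
  apply/chainP => _ _ /imsetP[i iA ->] /imsetP[j jA ->] /=.
  have := inc i j iA jA; have := inc j i jA iA.
  case: (ltngtP i j) => [_ _ /(_ isT)|_ /(_ isT) lt _|/val_inj-> _ _].
  - by move=> ->.
  - by rewrite ltnNge ltnW.
  - by rewrite ltnn.
suff : lis w <= n - #|perm_shadow w|.
  have : #|perm_shadow w| <= n; last by lia.
  have := H set0; rewrite cards0 addn0; apply.
  by apply/forall_inP => i; rewrite inE.
by apply/bigmax_leqP => A /H; lia.
Qed.

Lemma card_ord_lt n j : j <= n -> #|[set y : 'I_n | y < j]| = j.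
Proof.
move=> jn; have inj : injective (widen_ord jn) by move=> x y /(congr1 val) /= /val_inj.
rewrite -[RHS]card_ord -(card_imset _ inj); apply: eq_card => y; rewrite inE.
apply/idP/imsetP => [yj|[x _ ->]]; last exact: ltn_ord x.
by exists (Ordinal yj) => //; apply: val_inj.
Qed.

(** The columns [P] missing from [R] serve as the final tableau row, and a reading of all [n] rows
    is the required permutation. *)
Lemma perm_shadow_exists n (R : {set 'I_n * 'I_n}) :
    rook_placement R ->
    (forall (j : nat) (C : {set 'I_n * 'I_n}), j <= n -> C \subset left_of R j ->
       chain C -> #|C| + #|left_of R j| <= j) ->
    (forall (j : nat) (C : {set 'I_n * 'I_n}), j <= n ->
       C \subset [set p in R | p.2 < j] ->
       chain C -> #|C| + #|[set p in R | p.2 < j]| <= j) ->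
  exists w : 'S_n, perm_shadow w = R /\ n <= lis w + #|R|.
Proof.
move=> rookR rowR colR; pose P : {set 'I_n} := ~: [set p.2 | p : 'I_n * 'I_n in R].
have cardcol (A : {set 'I_n * 'I_n}) : A \subset R ->
    #|[set p.2 | p : 'I_n * 'I_n in A]| = #|A|.
  move=> /subsetP AR; apply: card_in_imset => p q /AR pR /AR qR E.
  by apply: (rook_placementP _ rookR) => //; right.
have [|||||w [lev rd]] := @reading_exists n n R P (leqnn n) rookR.
- by move=> p _; apply: ltn_ord.
- move=> x y xy; rewrite !inE negbK; apply/imsetP.
  by exists (x, y).
- by have := cardsC [set p.2 | p : 'I_n * 'I_n in R]; rewrite cardcol // card_ord addnC.
- exact: rowR.
- move=> j C jn CR chC Cj.
  pose Rj := [set p in R | p.2 < j].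
  have CRj : C \subset Rj.
    by apply/subsetP => p pC; rewrite inE (subsetP CR p pC) Cj.
  have RjR : Rj \subset R by apply/subsetP => p; rewrite inE => /andP[].
  have := colR j C jn CRj chC.
  (* Each of the first [j] columns either lies in [P] or holds a rook of [R], which turns the column
     condition on [R] into a bound by the rank of [P]. *)
  suff E : rank P j + #|Rj| = j by rewrite -[leqRHS]E leq_add2r.
  rewrite -(cardcol _ RjR) -[RHS](card_ord_lt jn).
  rewrite -(cardsID P [set y : 'I_n | y < j]); congr (_ + _).
    by apply: eq_card => y; rewrite !inE andbC.
  apply: eq_card => y; rewrite in_setD !inE negbK.
  apply/imsetP/andP => [[p pRj ->]|[/imsetP[p pR ->] pj]].
    move: pRj; rewrite inE => /andP[pR pj]; split=> //.
    by apply/imsetP; exists p.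
  by exists p; rewrite // inE pR.
have w_inj : injective w by move=> x y; apply: (reading_inj rd).
pose s := perm w_inj; have sE x : s x = w x by rewrite permE.
have mono (x1 x2 : 'I_n) : x1 < x2 -> s x1 < s x2 -> lev x1 < lev x2.
  by rewrite !sE => lt; apply: (reading_mono rd).
have pred (x2 : 'I_n) : 0 < lev x2 ->
    exists x1 : 'I_n, [/\ x1 < x2, s x1 < s x2 & lev x2 = (lev x1).+1].
  move=> /(reading_pred rd (ltn_ord x2))[x1 H].
  by exists x1; rewrite !sE.
exists s; split.
  have cornerE x y : corner s lev x y <-> corner w lev x y.
    by split=> -[x1 H]; exists x1; move: H; rewrite sE.
  apply/setP => -[x y]; apply/idP/idP.
    by move=> /(mem_perm_shadow mono pred)/cornerE/(reading_corner rd y (ltn_ord x)).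
  by move=> /(reading_corner rd y (ltn_ord x))/cornerE/(mem_perm_shadow mono pred).
have cardPR : n = #|P| + #|R|.
  have := cardsC [set p.2 | p : 'I_n * 'I_n in R].
  by rewrite cardcol // card_ord addnC.
rewrite [leqLHS]cardPR leq_add2r.
(* The largest entry of [P] has level [#|P| - 1], so it ends an increasing subsequence of length
   [#|P| = n - #|R|]. *)
have [->|] := posnP #|P|; first by [].
rewrite -(rank_full P (leqnn n)) => rk.
have [y [yP _ rky]] := rank_pred rk.
have [x [_ _ levx]] := reading_row rd yP.
have := lev_lt_lis pred x; rewrite levx.
by rewrite -rky rank_full.
Qed.

(** * Straightening rook indicators *)

(** The base [n.+1] lets one rook outweigh [n] rooks on later antidiagonals; the symmetry in the
    coordinates makes the weight invariant under transposition. *)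
Definition weight n (p : 'I_n * 'I_n) : nat := n.+1 ^ (n + n - p.1 - p.2).

Definition total_weight n (R : {set 'I_n * 'I_n}) : nat := \sum_(p in R) weight p.

(** The weight alternative allows [#|R1| < #|R2|] as well, so an upper bound on the size of a union
    suffices there. *)
Definition smaller n (R1 R2 : {set 'I_n * 'I_n}) : bool :=
  (#|R1| < #|R2|) || (#|R1| <= #|R2|) && (total_weight R1 < total_weight R2).

Definition graph_on n (T : {set 'I_n}) (f : 'I_n -> 'I_n) : {set 'I_n * 'I_n} :=
  [set (f t, t) | t in T].

Lemma card_graph_on n (T : {set 'I_n}) f : #|graph_on T f| = #|T|.
Proof. by rewrite card_imset // => s t []. Qed.

Lemma total_weight_graph_on n (T : {set 'I_n}) f :
  total_weight (graph_on T f) = \sum_(t in T) weight (f t, t).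
Proof. by rewrite /total_weight big_imset //= => s t _ _ []. Qed.

Lemma total_weightU n (A B : {set 'I_n * 'I_n}) :
  total_weight (A :|: B) <= total_weight A + total_weight B.
Proof.
rewrite /total_weight big_mkcond [X in _ <= X + _]big_mkcond.
rewrite [X in _ <= _ + X]big_mkcond -big_split leq_sum // => p _.
by rewrite inE; case: (p \in A); case: (p \in B) => //=; rewrite ?leq_addr ?addn0.
Qed.

(* The first column [d] where [f] and [c] differ dominates: all points of [f] from [d] on lie
   on strictly later antidiagonals than [(c d, d)], and there are at most [n] of them. *)
Lemma total_weight_lt n (j : nat) (T : {set 'I_n}) (c f : 'I_n -> 'I_n) :
    {in T &, forall s t : 'I_n, s < t -> c s < c t} ->
    {in T, forall t, c t < j} ->
    {in T &, injective f} ->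
    {in T, forall t, j <= f t \/ exists2 s, s \in T & f t = c s} ->
    (exists2 t, t \in T & f t != c t) ->
  total_weight (graph_on T f) < total_weight (graph_on T c).
Proof.
move=> c_inc c_lt f_inj f_img [t0 t0T ft0]; rewrite !total_weight_graph_on.
have Pt0 : (t0 \in T) && (f t0 != c t0) by rewrite t0T.
case: (arg_minnP (P := fun t => (t \in T) && (f t != c t)) val Pt0) => d /andP[dT fd] dmin.
have feq t : t \in T -> t < d -> f t = c t.
  move=> tT td; apply/eqP; apply: contraLR td => ft; rewrite -leqNgt.
  by apply: dmin; rewrite tT.
rewrite (bigID (fun t : 'I_n => t < d)) [ltnRHS](bigID (fun t : 'I_n => t < d)) /=.
have -> : \sum_(t in T | t < d) weight (f t, t) = \sum_(t in T | t < d) weight (c t, t).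
  by apply: eq_bigr => t /andP[tT td]; rewrite feq.
rewrite ltn_add2l; set e := n + n - c d - d.
have e_gt0 : 0 < e by rewrite /e; have := ltn_ord d; have := ltn_ord (c d); lia.
(* Either [f t >= j > c d], or [f t = c s]. The values [c s] with [s < d] are already taken by
   [f s], so [s >= d] by injectivity, and [s = d] leaves only [t > d]. *)
have late (t : 'I_n) : t \in T -> d <= t -> c d + d < f t + t.
  move=> tT dt; case: (f_img t tT) => [jf|[s sT fE]].
    by have := c_lt d dT; lia.
  have ds : d <= s.
    rewrite leqNgt; apply/negP => sd; have := feq s sT sd; rewrite -fE.
    by move=> /(f_inj _ _ sT tT) E; subst s; lia.
  have := ds; rewrite leq_eqVlt => /orP[/eqP/val_inj E|lt]; last first.
    by have := c_inc d s dT sT lt; rewrite fE; lia.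
  subst s; rewrite fE ltn_add2l ltn_neqAle dt andbT; apply/eqP => /val_inj E.
  by subst t; rewrite fE eqxx in fd.
apply: (@leq_ltn_trans (n * n.+1 ^ e.-1)).
  apply: (@leq_trans (\sum_(t in T | ~~ (t < d)) n.+1 ^ e.-1)).
    apply: leq_sum => t /andP[tT]; rewrite -leqNgt => dt.
    have n_gt0 : 1 < n.+1 by have := ltn_ord d; lia.
    rewrite leq_exp2l //= /e; have := late t tT dt.
    by have := ltn_ord d; have := ltn_ord (c d); lia.
  rewrite sum_nat_cond_const leq_mul2r; apply/orP; right.
  by rewrite -[leqRHS]card_ord max_card.
apply: (@leq_trans (weight (c d, d))).
  by rewrite /weight /= -/e -[in X in _ < X](prednK e_gt0) expnS ltn_pmul2r ?expn_gt0.
by rewrite (bigD1 d) ?dT ?ltnn //= leq_addr.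
Qed.

Lemma perm_extendsP n (w : 'S_n) (R : {set 'I_n * 'I_n}) :
  reflect (forall p : 'I_n * 'I_n, p \in R -> w p.1 = p.2) (perm_extends w R).
Proof.
apply: (iffP subsetP) => H [x y] xy; first by have := H _ xy; rewrite mem_perm_graph => /eqP.
by rewrite mem_perm_graph -[y](H _ xy).
Qed.

(** * Rewriting a placement that violates a chain condition *)

Section Reduction.

Variables (F : fieldType) (n : nat).
Implicit Types (R Q C : {set 'I_n * 'I_n}) (S T U : {set 'I_n}) (w : 'S_n).
Local Open Scope ring_scope.

Definition ext_ind R w : F := (perm_extends w R)%:R.

Lemma rook_indE R w : rook_ind F R w = ext_ind R w.
Proof. by rewrite ffunE /ext_ind; case: perm_extends. Qed.

Lemma ext_indU R Q w : ext_ind (R :|: Q) w = ext_ind R w * ext_ind Q w.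
Proof. by rewrite /ext_ind /perm_extends subUset -natrM mulnb. Qed.

Lemma ext_ind_nonrook R w : ~~ rook_placement R -> ext_ind R w = 0.
Proof.
rewrite /ext_ind; case: perm_extendsP => // H /negP[].
apply/rook_placementP => -[x1 y1] [x2 y2] /H /= <- /H /= <- [-> //|].
by move=> /perm_inj ->.
Qed.

Lemma ext_ind_graph_on T (f : 'I_n -> 'I_n) w :
  ext_ind (graph_on T f) w = \prod_(t in T) (w (f t) == t)%:R.
Proof.
rewrite /ext_ind; case: perm_extendsP => H.
  rewrite big1 // => t tT; have /= -> := H (f t, t); rewrite ?eqxx //.
  exact: imset_f.
have [t tT wt] : exists2 t, t \in T & w (f t) != t.
  case: (pickP [pred t in T | w (f t) != t]) => [t /andP[tT wt]|H']; first by exists t.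
  by case: H => _ /imsetP[t tT ->]; apply/eqP; have := H' t; rewrite /= tT => /negbFE.
by rewrite (bigD1 t) //= (negbTE wt) mul0r.
Qed.

(** Each factor is the sum over [x] in [U] of [[w x = t]]; distributing the product picks a row for
    every column of [S]. The default [x0] off [S] makes each choice occur once. *)
Lemma ext_ind_expand Q S U w (x0 : 'I_n) :
  ext_ind Q w * \prod_(t in S) ((w^-1)%g t \in U)%:R =
  \sum_(f in pffun_on x0 (mem S) (mem U)) ext_ind (Q :|: graph_on S f) w.
Proof.
under eq_bigr => t _.
  have -> : ((w^-1)%g t \in U)%:R = \sum_(x in U) (w x == t)%:R :> F.
    have [xU|xU] := boolP (_ \in U).
      rewrite (bigD1 ((w^-1)%g t)) //= permKV eqxx big1 ?addr0 // => x /andP[_ ne].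
      by case: eqP => // E; rewrite -E permK eqxx in ne.
    rewrite big1 // => x xU'; case: eqP => // E.
    by rewrite -E permK xU' in xU.
  over.
rewrite (big_distr_big x0) big_distrr /=; apply: eq_bigr => f _.
by rewrite ext_indU ext_ind_graph_on.
Qed.

(** Taking [g] to be the identity or inversion lets one argument serve both rows and columns. *)
Definition pull (g : 'S_n -> 'S_n) R : statistic F n := [ffun w => ext_ind R (g w)].

Lemma pull_mem_chain (g : 'S_n -> 'S_n) (V : {vspace statistic F n}) R C j :
    rook_placement R -> chain C -> C \subset left_of R j -> (j <= n)%N ->
    (j < #|C| + #|left_of R j|)%N ->
    (forall R', smaller R' R -> pull g R' \in V) ->
  pull g R \in V.
Proof.
move=> rookR /chainP chC CRj jn ltj HV.
have rookP := rook_placementP _ rookR.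
have Cj (p : 'I_n * 'I_n) : p \in C -> p \in R /\ (p.1 < j)%N.
  by move=> /(subsetP CRj); rewrite inE => /andP[].
have CR : C \subset R by apply/subsetP => p /Cj[].
pose T : {set 'I_n} := [set p.2 | p : 'I_n * 'I_n in C].
pose U : {set 'I_n} := [set x : 'I_n | (x < j)%N & x \notin [set p.1 | p : 'I_n * 'I_n in R]].
pose X : {set 'I_n} := [set x : 'I_n | (j <= x)%N || (x \in [set p.1 | p : 'I_n * 'I_n in C])].
pose Q := R :\: C.
have cardT : #|T| = #|C|.
  apply: card_in_imset => p q /Cj[pR _] /Cj[qR _] E.
  by apply: rookP => //; right.
have cardU : (#|U| + #|left_of R j| = j)%N.
  have <- : #|[set p.1 | p : 'I_n * 'I_n in left_of R j]| = #|left_of R j|.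
    apply: card_in_imset => p q; rewrite !inE => /andP[pR _] /andP[qR _] E.
    by apply: rookP => //; left.
  rewrite -[RHS](card_ord_lt jn).
  rewrite -(cardsID [set p.1 | p : 'I_n * 'I_n in R] [set x : 'I_n | (x < j)%N]) addnC.
  congr (_ + _)%N; last by apply: eq_card => x; rewrite !inE andbC.
  apply: eq_card => x; rewrite in_setI inE.
  apply/imsetP/andP => [[p pRj ->]|[xj /imsetP[p pR xE]]].
    by move: pRj; rewrite inE => /andP[pR pj]; split=> //; apply/imsetP; exists p.
  by exists p; rewrite // inE pR -xE.
have UT : (#|U| < #|T|)%N by rewrite cardT; lia.
have [p0 p0C] : exists p, p \in C.
  by apply/set0Pn; rewrite -cards_eq0 -cardT; lia.
pose x0 : 'I_n := p0.1.
(* This is [C] as a map from columns to rows, with the value [x0] off [T] that [pffun_on]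
   prescribes. *)
pose c : {ffun 'I_n -> 'I_n} := [ffun t => if [pick p in C | p.2 == t] is Some p then p.1 else x0].
have cE (p : 'I_n * 'I_n) : p \in C -> c p.2 = p.1.
  move=> pC; rewrite ffunE; case: pickP => [q /andP[qC /eqP E]|/(_ p)].
    by rewrite (rookP q p) //; [case: (Cj q qC) | case: (Cj p pC) | right].
  by rewrite pC eqxx.
have cN t : t \notin T -> c t = x0.
  move=> tT; rewrite ffunE; case: pickP => [q /andP[qC /eqP E]|//].
  by case/negP: tT; apply/imsetP; exists q.
have graph_c : graph_on T c = C.
  apply/setP => -[x t]; apply/imsetP/idP => [[_ /imsetP[p pC ->] [-> ->]]|xtC].
    by rewrite cE //; case: p pC.
  exists t; first by apply/imsetP; exists (x, t).
  by rewrite (cE _ xtC).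
have c_pffun : c \in pffun_on x0 (mem T) (mem X).
  apply/pffun_onP; split.
    by apply/subsetP => t; rewrite inE; apply: contraR => /cN ->.
  move=> x /imageP[t tT ->]; have /imsetP[p pC ->] := tT.
  by rewrite cE // inE; apply/orP; right; apply/imsetP; exists p.
(* With [z] zero off [T], the product of [z + 1] over all columns expands over all sets [J], and
   [lower J] vanishes unless [J] is contained in [T]. *)
pose z w (t : 'I_n) : F := if t \in T then - ((w^-1)%g t \in U)%:R else 0.
pose lower (J : {set 'I_n}) : statistic F n :=
  [ffun w => ext_ind Q (g w) * \prod_t (if t \in J then z (g w) t else 1)].
(* If [w] extends [Q], a rook of [Q] in the row of [t] would lie in column [t], which belongs to a
   rook of [C]. *)
have rows_XU w t : perm_extends w Q -> t \in T -> ((w^-1)%g t \in X) = ~~ ((w^-1)%g t \in U).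
  move=> /perm_extendsP wQ tT; rewrite !inE negb_and negbK -leqNgt; congr (_ || _).
  apply/imsetP/imsetP => -[p pRC E]; exists p => //; first exact: (subsetP CR).
  case/imsetP: (tT) => q qC tq; have [pC|pC] := boolP (p \in C); first by [].
  have pQ : p \in Q by rewrite inE pC.
  have pq : p = q.
    apply: rookP => //; first exact: (subsetP CR).
    by right; rewrite -tq -(wQ p pQ) -E permKV.
  by rewrite pq qC in pC.
have expand w : \sum_(f in pffun_on x0 (mem T) (mem X)) ext_ind (Q :|: graph_on T f) w =
    ext_ind Q w * \prod_t (z w t + 1).
  rewrite -ext_ind_expand [X in _ * X]big_mkcond.
  rewrite /ext_ind; case: (boolP (perm_extends w Q)) => wQ; last by rewrite !mul0r.
  congr (_ * _); apply: eq_bigr => t _; rewrite /z; case: ifP => tT; last by rewrite add0r.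
  by rewrite rows_XU //; case: (_ \in U); rewrite /= ?addNr ?oppr0 ?add0r.
have sum_lower w : \sum_(J : {set 'I_n}) lower J w =
    \sum_(f in pffun_on x0 (mem T) (mem X)) ext_ind (Q :|: graph_on T f) (g w) :> F.
  rewrite expand bigA_distr big_distrr /=; apply: eq_bigr => J _.
  by rewrite ffunE.
have QC : Q :|: C = R by rewrite /Q setUC -{1}(setIidPr CR) setID.
(* The subset sum equals the sum over all placements of [T] in the rows [X]; the choice [f = c]
   gives [R] itself and is isolated. *)
have pullR : pull g R = \sum_(J : {set 'I_n}) lower J -
    \sum_(f in pffun_on x0 (mem T) (mem X) | f != c) pull g (Q :|: graph_on T f).
  apply/ffunP => w; rewrite !ffunE !sum_ffunE.
  rewrite sum_lower (bigD1 c) //= graph_c QC.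
  by under [in X in _ - X]eq_bigr => f _ do rewrite ffunE; rewrite addrK.
have cardQ : (#|Q| + #|T| = #|R|)%N.
  by rewrite cardT addnC -(cardsID C R) (setIidPr CR).
rewrite pullR; apply: rpredB; apply: rpred_sum.
- move=> J _; have [JT|JT] := boolP (J \subset T); last first.
    have [t tJ tT] := subsetPn JT.
    suff -> : lower J = 0 by apply: mem0v.
    apply/ffunP => w; rewrite !ffunE (bigD1 t) //= tJ /z (negbTE tT) mul0r.
    by rewrite mulr0.
  have lowerE w : lower J w = (-1) ^+ #|J| *
      (ext_ind Q (g w) * \prod_(t in J) (((g w)^-1)%g t \in U)%:R).
    rewrite ffunE mulrCA; congr (_ * _); rewrite -big_mkcond /=.
    rewrite -prodr_const -big_split /=; apply: eq_bigr => t tJ.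
    by rewrite /z (subsetP JT) // mulN1r.
  (* For [J = T] the term vanishes, since an injective map cannot send [T] into the smaller [U]. A
     proper [J] leaves fewer rooks than [R] has. *)
  have [E|neJ] := eqVneq J T.
    suff -> : lower J = 0 by apply: mem0v.
    apply/ffunP => w; rewrite lowerE ffunE E.
    have [t tT tU] : exists2 t, t \in T & ((g w)^-1)%g t \notin U.
      have inj : injective ((g w)^-1)%g := @perm_inj _ _.
      case: (pickP [pred t in T | ((g w)^-1)%g t \notin U]) => [t /andP[tT tU]|H].
        by exists t.
      move: UT; rewrite ltnNge -(card_imset T inj) subset_leq_card //.
      apply/subsetP => _ /imsetP[t tT ->]; have := H t; rewrite /= tT.
      by move/negbFE.
    by rewrite [X in _ * (_ * X)](bigD1 t) //= (negbTE tU) mul0r !mulr0.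
  have -> : lower J = (-1) ^+ #|J| *: 
      \sum_(f in pffun_on x0 (mem J) (mem U)) pull g (Q :|: graph_on J f).
    apply/ffunP => w; rewrite lowerE !ffunE sum_ffunE (ext_ind_expand _ _ _ _ x0).
    by under [in RHS]eq_bigr => f _ do rewrite ffunE.
  apply: rpredZ; apply: rpred_sum => f _; apply: HV; apply/orP; left.
  have ltJ : (#|J| < #|T|)%N by apply: proper_card; rewrite properEneq neJ.
  rewrite -cardQ; apply: leq_ltn_trans (_ : #|Q| + #|J| < _)%N; last by rewrite ltn_add2l.
  by rewrite -(card_graph_on J f) cardsU leq_subr.
- move=> f /andP[fX fc].
  (* Sets that are not placements have zero indicator, so [f] may be assumed injective on [T], as
     the weight comparison requires. *)
  have [rookf|nrook] := boolP (rook_placement (Q :|: graph_on T f)); last first.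
    suff -> : pull g (Q :|: graph_on T f) = 0 by apply: mem0v.
    by apply/ffunP => w; rewrite !ffunE ext_ind_nonrook.
  apply: HV; apply/orP; right; apply/andP; split.
    by rewrite -cardQ -(card_graph_on T f) cardsU leq_subr.
  apply: leq_ltn_trans (total_weightU _ _) _.
  have -> : total_weight R = (total_weight Q + total_weight C)%N.
    by rewrite /total_weight (big_setID C) /= (setIidPr CR) addnC.
  rewrite ltn_add2l -graph_c; apply: (@total_weight_lt _ j).
  + move=> _ _ /imsetP[p pC ->] /imsetP[q qC ->]; rewrite !cE // => lt.
    by rewrite chC.
  + by move=> _ /imsetP[p pC ->]; rewrite cE //; case: (Cj p pC).
  + move=> s t sT tT E.
    have := rook_placementP _ rookf (f s, s) (f t, t).
    rewrite !inE !imset_f ?orbT //.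
    by move=> /(_ isT isT (or_introl E)) [].
  + move=> t tT; have [_ /(_ (f t))] := pffun_onP fX.
    rewrite inE => /(_ (image_f _ tT)) /orP[|/imsetP[p pC ->]]; first by left.
    by right; exists p.2; [apply/imsetP; exists p | rewrite cE].
  + have [supp_f _] := pffun_onP fX.
    case: (pickP [pred t in T | f t != c t]) => [t /andP[tT ft]|H]; first by exists t.
    case/eqP: fc; apply/ffunP => t; have [tT|tT] := boolP (t \in T).
      by have := H t; rewrite /= tT => /negbFE/eqP.
    rewrite cN //; apply/eqP; apply: contraR tT => ft.
    by apply: (subsetP supp_f); rewrite inE.
Qed.

End Reduction.

(** * Exchanging rows and columns *)

Definition transpose n (R : {set 'I_n * 'I_n}) : {set 'I_n * 'I_n} :=
  [set (p.2, p.1) | p in R].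

Lemma swap_inj n : injective (fun p : 'I_n * 'I_n => (p.2, p.1)).
Proof. by move=> [a b] [c d] [-> ->]. Qed.

Lemma mem_transpose n (R : {set 'I_n * 'I_n}) (p : 'I_n * 'I_n) :
  (p \in transpose R) = ((p.2, p.1) \in R).
Proof.
case: p => x y; apply/imsetP/idP => [[[a b] ab [-> ->]] //|yx].
by exists (y, x).
Qed.

Lemma transposeK n : involutive (@transpose n).
Proof. by move=> R; apply/setP => -[x y]; rewrite !mem_transpose. Qed.

Lemma card_transpose n (R : {set 'I_n * 'I_n}) : #|transpose R| = #|R|.
Proof. by apply: card_imset; apply: swap_inj. Qed.

Lemma transpose_sub n (R S : {set 'I_n * 'I_n}) :
  (transpose R \subset transpose S) = (R \subset S).
Proof.
apply/idP/idP => [H|]; last exact: imsetS.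
by rewrite -[R]transposeK -[S]transposeK; apply: imsetS.
Qed.

Lemma total_weight_transpose n (R : {set 'I_n * 'I_n}) :
  total_weight (transpose R) = total_weight R.
Proof.
rewrite /total_weight big_imset /=; last by move=> p q _ _; apply: swap_inj.
by apply: eq_bigr => p _; rewrite /weight /= subnAC.
Qed.

Lemma smaller_transpose n (R S : {set 'I_n * 'I_n}) :
  smaller (transpose R) S = smaller R (transpose S).
Proof. by rewrite /smaller !card_transpose !total_weight_transpose. Qed.

Lemma rook_transpose n (R : {set 'I_n * 'I_n}) :
  rook_placement R -> rook_placement (transpose R).
Proof.
move=> /rook_placementP H; apply/rook_placementP => p q.
rewrite !mem_transpose => pR qR E; apply: swap_inj; apply: H => //=.
by case: E; [right | left].
Qed.

Lemma chain_transpose n (C : {set 'I_n * 'I_n}) : chain C -> chain (transpose C).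
Proof.
move=> /chainP H; apply/chainP => p q; rewrite !mem_transpose => pC qC.
by rewrite -(H _ _ pC qC).
Qed.

Lemma ext_ind_transpose (F : fieldType) n (R : {set 'I_n * 'I_n}) (w : 'S_n) :
  ext_ind F (transpose R) (w^-1)%g = ext_ind F R w.
Proof.
congr (_%:R)%R; congr nat_of_bool; apply/perm_extendsP/perm_extendsP => H p pR.
  have /= <- := H (p.2, p.1); last by rewrite mem_transpose; case: p pR.
  by rewrite permKV.
by move: pR; rewrite mem_transpose => /H /= <-; rewrite permK.
Qed.

Definition row_ok n (R : {set 'I_n * 'I_n}) : bool :=
  [forall j : 'I_n.+1, forall C : {set 'I_n * 'I_n},
     (C \subset left_of R j) && chain C ==> (#|C| + #|left_of R j| <= j)].

Lemma row_okP n (R : {set 'I_n * 'I_n}) (j : nat) (C : {set 'I_n * 'I_n}) :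
  row_ok R -> j <= n -> C \subset left_of R j -> chain C -> #|C| + #|left_of R j| <= j.
Proof.
move=> /forallP H jn CR chC.
by have /forallP/(_ C) := H (inord j); rewrite inordK ?ltnS // CR chC.
Qed.

Lemma pull_mem_row (F : fieldType) n (g : 'S_n -> 'S_n) (V : {vspace statistic F n})
    (R : {set 'I_n * 'I_n}) :
    rook_placement R -> ~~ row_ok R ->
    (forall R', smaller R' R -> pull F g R' \in V) ->
  pull F g R \in V.
Proof.
move=> rookR /forallPn[j /forallPn[C]]; rewrite negb_imply -ltnNge.
move=> /andP[/andP[CR chC] lt]; apply: (pull_mem_chain rookR chC CR _ lt).
by rewrite -ltnS.
Qed.

(** A violated row condition is reduced at [w], a violated column condition at the inverse of [w];
    with neither, [R] is admissible. Leaving [V] arbitrary defers the induction. *)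
Lemma rook_ind_mem_or_shadow (F : fieldType) n (V : {vspace statistic F n})
    (R : {set 'I_n * 'I_n}) :
    (forall R', smaller R' R -> rook_ind F R' \in V) ->
  rook_ind F R \in V \/
  exists w : 'S_n, perm_shadow w = R /\ n <= lis w + #|R|.
Proof.
move=> HV.
have pull_id S : pull F id S = rook_ind F S by apply/ffunP => w; rewrite ffunE rook_indE.
have pull_inv S : pull F invg (transpose S) = rook_ind F S.
  by apply/ffunP => w; rewrite ffunE rook_indE ext_ind_transpose.
have [rookR|nrook] := boolP (rook_placement R); last first.
  left; suff -> : rook_ind F R = 0%R by apply: mem0v.
  by apply/ffunP => w; rewrite rook_indE ext_ind_nonrook ?ffunE.
have [rowR|rowR] := boolP (row_ok R); last first.
  left; rewrite -pull_id; apply: pull_mem_row => // R' /HV.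
  by rewrite pull_id.
have [colR|colR] := boolP (row_ok (transpose R)); last first.
  left; rewrite -pull_inv; apply: pull_mem_row => // [|R']; first exact: rook_transpose.
  by rewrite -{1}(transposeK R') smaller_transpose transposeK => /HV; rewrite -pull_inv transposeK.
right; apply: perm_shadow_exists => // [j C|j C jn CR chC]; first exact: row_okP.
have leftT : left_of (transpose R) j = transpose [set p in R | p.2 < j].
  by apply/setP => p; rewrite !inE !mem_transpose inE.
have := row_okP (C := transpose C) colR jn.
rewrite leftT transpose_sub !card_transpose; apply=> //.
exact: chain_transpose.
Qed.

(** * Spanning, freeness and the basis *)

Definition shadow_family (F : fieldType) n k : seq (statistic F n) :=
  [seq rook_ind F (perm_shadow w) | w <- enum {: 'S_n} & n - k <= lis w].

(** The order [smaller] is unwound into strong induction on the size and, within one size, on the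
    weight. *)
Lemma rook_ind_span (F : fieldType) n k (R : {set 'I_n * 'I_n}) :
  #|R| <= k -> rook_ind F R \in <<shadow_family F n k>>%VS.
Proof.
have [a Ea] : exists a, #|R| = a by exists #|R|.
have [b Eb] : exists b, total_weight R = b by exists (total_weight R).
elim/ltn_ind: a R b Ea Eb => a IHa R b; elim/ltn_ind: b R => b IHb R Ea Eb; rewrite Ea => ak.
have [R' /orP[lt|/andP[le lt]]|//|[w [Ew lew]]] :=
    @rook_ind_mem_or_shadow F n <<shadow_family F n k>>%VS R.
- rewrite Ea in lt; apply: (IHa _ lt R' _ erefl erefl).
  exact: leq_trans (ltnW lt) ak.
- rewrite Ea leq_eqVlt in le; rewrite Eb in lt; case/predU1P: le => [E|lt'].
    by apply: (IHb _ lt R' E erefl); rewrite E.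
  apply: (IHa _ lt' R' _ erefl erefl).
  exact: leq_trans (ltnW lt') ak.
rewrite -Ew; apply/memv_span/map_f; rewrite mem_filter mem_enum andbT leq_subLR.
by rewrite addnC; apply: leq_trans lew _; rewrite leq_add2l Ea.
Qed.

(** A placement of fewer than [k <= n] rooks misses some row [x]; splitting by the value of [w x]
    adds one rook at a time, and sums over non-placements vanish. *)
Lemma rook_ind_Loc (F : fieldType) n k (R : {set 'I_n * 'I_n}) :
  k <= n -> #|R| <= k -> rook_ind F R \in Loc F n k.
Proof.
move=> kn Rk.
have [d Ed] : exists d, #|R| + d = k by exists (k - #|R|); lia.
elim: d R Ed Rk => [|d IH] R Ed Rk.
  have [rookR|nrook] := boolP (rook_placement R).
    by apply/memv_span/map_f; rewrite mem_filter rookR mem_enum -Ed addn0 eqxx.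
  suff -> : rook_ind F R = 0%R by apply: mem0v.
  by apply/ffunP => w; rewrite rook_indE ext_ind_nonrook ?ffunE.
have [x xR] : exists x : 'I_n, x \notin [set p.1 | p : 'I_n * 'I_n in R].
  case: (pickP [pred x : 'I_n | x \notin [set p.1 | p : 'I_n * 'I_n in R]]) => [x|H].
    by exists x.
  have : n <= #|R|.
    apply: leq_trans (leq_imset_card (fun p : 'I_n * 'I_n => p.1) R).
    rewrite -[leqLHS]card_ord; apply/subset_leq_card/subsetP => x _.
    by have := H x => /negbFE.
  by rewrite leqNgt (leq_trans _ kn) // -Ed addnS ltnS leq_addr.
have -> : rook_ind F R = (\sum_(y : 'I_n) rook_ind F ((x, y) |: R))%R.
  apply/ffunP => w; rewrite sum_ffunE rook_indE (bigD1 (w x)) //= big1 => [|y ne].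
    rewrite addr0 rook_indE ext_indU; suff -> : ext_ind F [set (x, w x)] w = 1%R by rewrite mul1r.
    by rewrite /ext_ind; case: perm_extendsP => // -[] p; rewrite inE => /eqP->.
  rewrite rook_indE /ext_ind; case: perm_extendsP => // H.
  by have := H (x, y); rewrite !inE eqxx => /(_ isT) /= E; rewrite E eqxx in ne.
apply: rpred_sum => y _; have xyR : #|(x, y) |: R| = #|R|.+1.
  rewrite cardsU1; case: (boolP (_ \in R)) => // xyR; case/negP: xR.
  by apply/imsetP; exists (x, y).
by apply: IH; rewrite xyR -?Ed ?addSnnS // addnS ltnS leq_addr.
Qed.

Lemma rook_ind_perm_graph (F : fieldType) n (w v : 'S_n) :
  rook_ind F (perm_graph w) v = (v == w)%:R%R.
Proof.
rewrite rook_indE; congr (_%:R)%R; congr nat_of_bool.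
apply/perm_extendsP/eqP => [H|->]; last by case=> x y; rewrite mem_perm_graph => /eqP.
by apply/permP => x; have /= -> := H (x, w x); rewrite ?mem_perm_graph.
Qed.

(** For [k = n] the indicators of permutation graphs are the delta functions, so the family spans a
    space whose dimension equals its length. *)
Lemma free_shadow_family (F : fieldType) n : free (shadow_family F n n).
Proof.
have size_fam : size (shadow_family F n n) = #|{: 'S_n}|.
  rewrite size_map size_filter cardE; apply/eqP; rewrite -all_count.
  by apply/allP => w _; rewrite subnn.
have full : (fullv <= <<shadow_family F n n>>)%VS.
  apply/subvP => f _.
  have -> : f = (\sum_(w : 'S_n) f w *: rook_ind F (perm_graph w))%R.
    apply/ffunP => v; rewrite sum_ffunE (bigD1 v) //= big1 ?addr0 => [|w ne].
      by rewrite ffunE rook_ind_perm_graph eqxx /GRing.scale /= mulr1.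
    by rewrite ffunE rook_ind_perm_graph eq_sym (negbTE ne) scaler0.
  apply: rpred_sum => w _; apply: rpredZ; apply: rook_ind_span.
  by rewrite card_perm_graph.
apply: (basis_free (U := fullv)); rewrite basisEdim full size_fam.
by rewrite dimvf /dim /= muln1.
Qed.

Theorem theorem3p16 (F : fieldType) (n k : nat) (n_ge1 : 1 <= n)
    (k_le_n : k <= n) :
  basis_of (Loc F n k)
    [seq rook_ind F (perm_shadow w) | w <- enum {: 'S_n} & n - k <= lis w].
Proof.
have sub : (<<shadow_family F n k>> <= Loc F n k)%VS.
  apply/span_subvP => f /mapP[w]; rewrite mem_filter leq_subLR => /andP[lew _] ->.
  apply: rook_ind_Loc => //; rewrite -(leq_add2r (lis w)).
  exact: leq_trans (card_perm_shadow w) lew.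
have span : (Loc F n k <= <<shadow_family F n k>>)%VS.
  apply/span_subvP => f /mapP[R]; rewrite mem_filter => /andP[/andP[_ /eqP Rk] _] ->.
  by apply: rook_ind_span; rewrite Rk.
rewrite -/(shadow_family F n k) basisEfree sub /=; apply/andP; split; last first.
  exact: leq_trans (dimvS span) (dim_span _).
(* For [k = n] the filter keeps every permutation; reordered, this free family begins with the
   family for [k]. *)
have := free_shadow_family F n; rewrite /shadow_family.
have -> : [seq w <- enum {: 'S_n} | n - n <= lis w] = enum {: 'S_n}.
  by apply/all_filterP/allP => w _; rewrite subnn.
rewrite -(perm_free (perm_map _ (permEl (perm_filterC (fun w => n - k <= lis w) _)))).
by rewrite map_cat => /catl_free.
Qed.
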